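(* Let $V$ be an $m$-dimensional complex vector space, let $Q$ be a non-degenerate symmetric bilinear form on $V$, and let $k$ be a nonnegative integer. Let $\Sigma_k$ be the set of $k$-dimensional isotropic linear subspaces of $V$ with respect to $Q$, and let $G = \{A \in GL(V) \mid Q(Av,Aw) = Q(v,w) \text{ for all } v,w \in V\}$, acting on $\Sigma_k$ by $(A,\Lambda) \mapsto A(\Lambda)$. Then the action of $G$ on $\Sigma_k$ is transitive; that is, for any two $\Lambda, \Lambda' \in \Sigma_k$ there exists $A \in G$ with $A(\Lambda) = \Lambda'$.
   Context: A $k$-dimensional linear subspace ($k$-plane) $\Lambda \subset V$ is called isotropic with respect to $Q$ if $Q|_{\Lambda\times\Lambda} = 0$, i.e. $Q(v,w)=0$ for all $v,w \in \Lambda$. (The set $\Sigma_k$ is non-empty if and only if $k \le m/2$.) *)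

(* Defs.v *)
From HB Require Import structures.
From mathcomp Require Import all_boot all_order all_algebra.
From mathcomp Require Import classical_sets reals.
From mathcomp Require Import complex.

Set Implicit Arguments.
Unset Strict Implicit.
Unset Printing Implicit Defensive.

Import Order.TTheory GRing.Theory Num.Theory.

Local Open Scope classical_set_scope.
Local Open Scope ring_scope.
Local Open Scope complex_scope.

Section IsotropicSubspaces.
Variables (R : realType) (V : vectType R[i]) (Q : {symmetric V}).

Definition isotropic (L : {vspace V}) : Prop :=
  forall v w, v \in L -> w \in L -> Q v w = 0.

Definition isotropic_planes (k : nat) : set {vspace V} :=
  [set L : {vspace V} | \dim L = k /\ isotropic L].

(* GL(V) is expressed by bijectivity of the endomorphism: the unit ring
   structure on 'End(V) needs V != 0, whereas V = 0 is allowed here. *)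
Definition orthogonal_group : set 'End(V) :=
  [set A : 'End(V) | bijective A /\ isometry Q Q A].

Lemma nondegenerateP :
  reflect (forall v, (forall w, Q v w = 0) -> v = 0) (nondegenerate Q).
Proof.
apply: (iffP eqP) => [rad0 v Qv0 | Qnd].
  apply/eqP; rewrite -memv0 -rad0; apply/mem_orthovP => w _; exact: Qv0.
apply/eqP; rewrite -subv0; apply/subvP => v /mem_orthovP Qv0.
by rewrite memv0; apply/eqP/Qnd => w; rewrite Qv0 ?memvf.
Qed.

Lemma orthogonal_group_act (k : nat) (A : 'End(V)) (L : {vspace V}) :
  orthogonal_group A -> isotropic_planes k L -> isotropic_planes k (A @: L)%VS.
Proof.
move=> [/bij_inj/lker0P Ainj Aiso] [dimL isoL]; split.
  by rewrite limg_dim_eq // (eqP Ainj) capv0.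
by move=> _ _ /memv_imgP[v vL ->] /memv_imgP[w wL ->]; rewrite Aiso isoL.
Qed.

End IsotropicSubspaces.

(* Main.v *)
Require Import Defs.
From HB Require Import structures.
From mathcomp Require Import all_boot all_order all_algebra.
From mathcomp Require Import classical_sets reals.
From mathcomp Require Import complex.
From mathcomp Require Import ring.

(** This is Witt's theorem for totally isotropic subspaces, and the argument
    works over every field in which 2 is invertible.  Bases of the two planes
    are matched one vector at a time: once an isometry carries the basis vectors
    already treated to their targets, the next vector x must be carried to its
    target y by an isometry that fixes those targets, which span W.  Here x and
    y are isotropic, orthogonal to W and outside W.

    If Q x y <> 0, the reflection along x - y exchanges x and y, and it fixes W
    because W is orthogonal to x - y ([isometry_of_isotropic_pair]).  Otherwise
    the move is made in two reflections, through an isotropic vector u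
    orthogonal to W and orthogonal neither to x nor to y
    ([isotropic_intermediate]).  Such a u exists because x and y, being outside
    W, each fail to be orthogonal to the orthogonal complement of W
    ([orthov_separation]), by a dimension count that rests on nondegeneracy. *)

Set Implicit Arguments.
Unset Strict Implicit.
Unset Printing Implicit Defensive.

Import Order.TTheory GRing.Theory Num.Theory.

Local Open Scope classical_set_scope.
Local Open Scope ring_scope.
Local Open Scope complex_scope.

Section Witt.
Variables (F : fieldType) (V : vectType F) (Q : {symmetric V}).

Lemma symmetric_formC u v : Q u v = Q v u.
Proof. by rewrite hermC expr0 mul1r. Qed.

Lemma symmetric_formZl c u v : Q (c *: u) v = c * Q u v.
Proof. by rewrite linearZl_LR. Qed.

Lemma symmetric_formZr c u v : Q u (c *: v) = c * Q u v.
Proof. by rewrite symmetric_formC symmetric_formZl symmetric_formC. Qed.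

Lemma isometry_comp (A B : 'End(V)) :
  isometry Q Q A -> isometry Q Q B -> isometry Q Q (A \o B)%VF.
Proof. by move=> isoA isoB v w; rewrite !lfunE /= isoA isoB. Qed.

(** Each vector of a spanning set of C imposes one linear condition on U, so the
    dimension drops by at most one per vector. *)
Lemma dim_cap_orthov (U C : {vspace V}) :
  (\dim U <= \dim (U :&: orthov Q C) + \dim C)%N.
Proof.
suff span_bound (X : seq V) :
    (\dim U <= \dim (U :&: orthov Q <<X>>) + size X)%N.
  have := span_bound (vbasis C).
  by rewrite (span_basis (vbasisP C)) size_tuple.
elim: X => [|x X IH]; first by rewrite span_nil orthov0 capvf addn0.
apply: leq_trans IH _; rewrite /= addnS -addSn leq_add2r.
set UX := (U :&: orthov Q <<X>>)%VS.
have le_cap : (UX :&: orthov Q <[x]> <= U :&: orthov Q <<x :: X>>)%VS.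
  rewrite span_cons; apply/subvP => v; rewrite !memv_cap.
  case/andP=> /andP[-> vX] vx /=.
  by rewrite memvE orthovD -!memvE vx vX.
have := leq_dim_orthov1 Q x UX; have := dimvS le_cap.
by case: (\dim UX) => // d le1 le2; rewrite ltnS (leq_trans le2 le1).
Qed.

Hypothesis ndQ : nondegenerate Q.

Lemma nondegenerate_eq0 v : (forall w, Q v w = 0) -> v = 0.
Proof.
move=> Qv0; apply/eqP; rewrite -memv0 -(eqP ndQ).
by apply/mem_orthovP => w _; apply: Qv0.
Qed.

(** The subspace U meets the orthogonal of a complement of its own orthogonal
    only in 0, since a common vector is orthogonal to everything. *)
Lemma dim_add_orthov (U : {vspace V}) :
  (\dim U + \dim (orthov Q U) <= \dim {:V})%N.
Proof.
set C := ((orthov Q U)^C)%VS.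
have cap0 : (U :&: orthov Q C = 0)%VS.
  apply/eqP; rewrite -subv0; apply/subvP => v; rewrite memv_cap memv0.
  case/andP=> vU /mem_orthovP vC; apply/eqP/nondegenerate_eq0 => w.
  have : w \in (orthov Q U + C)%VS by rewrite addv_complf memvf.
  case/memv_addP=> a /mem_orthovP aU [c cC ->].
  by rewrite linearDr /= (vC c) // addr0 symmetric_formC aU.
have := dim_cap_orthov U C; rewrite cap0 dimv0 add0n => leUC.
have := leq_add leUC (leqnn (\dim (orthov Q U))).
by rewrite dimv_compl subnK ?dimvS ?subvf.
Qed.

(** If the orthogonal complement of W were orthogonal to x, then W and W + <[x]>
    would have the same orthogonal complement, hence the same dimension. *)
Lemma orthov_separation (W : {vspace V}) x :
  x \notin W -> exists2 u, u \in orthov Q W & Q u x != 0.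
Proof.
move=> xW; have [le_orth|] := boolP (orthov Q W <= orthov Q <[x]>)%VS; last first.
  by case/subvPn=> u uW; rewrite mem_orthov1; exists u.
case/negP: xW; rewrite memvE.
set S := (<[x]> + W)%VS.
have orthS : (orthov Q W <= orthov Q S)%VS by rewrite orthovD le_orth subvv.
have dimSW : (\dim S <= \dim W)%N.
  rewrite -(leq_add2r (\dim (orthov Q W))).
  apply: leq_trans (leq_add (leqnn _) (dimvS orthS)) _.
  apply: leq_trans (dim_add_orthov S) _.
  by have := dim_cap_orthov fullv W; rewrite capfv addnC.
have /eqP -> : W == S by rewrite eqEdim addvSr dimSW.
exact: addvSl.
Qed.

Lemma isometry_bijective (A : 'End(V)) : isometry Q Q A -> bijective A.
Proof.
move=> isoA; have kerA : lker A == 0%VS.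
  rewrite -subv0; apply/subvP => v; rewrite memv_ker memv0 => /eqP Av0.
  by apply/eqP/nondegenerate_eq0 => w; rewrite -isoA Av0 linear0l.
by exists (A^-1)%VF; [exact: lker0_lfunK|exact: lker0_lfunVK].
Qed.

(** The isometry is the reflection along x - y: as Q (x - y) (x - y) is
    -2 * Q x y, the factor 2 cancels from the usual formula, which becomes
    v + (Q v (x - y) / Q x y) *: (x - y). *)
Lemma isometry_of_isotropic_pair x y :
    Q x x = 0 -> Q y y = 0 -> Q x y != 0 ->
  exists A : 'End(V),
    [/\ isometry Q Q A, A x = y & forall v, Q v x = Q v y -> A v = v].
Proof.
move=> Qxx Qyy Qxy; pose a := x - y.
have Qa v : Q v a = Q v x - Q v y by rewrite linearBr.
have Qaa : Q a a = - (Q x y *+ 2).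
  rewrite /a linearBl !linearBr /= Qxx Qyy (symmetric_formC y x); ring.
have xBa : x - a = y by rewrite subKr.
clearbody a; pose s v := v + (Q v a / Q x y) *: a.
have s_lin : linear s.
  move=> c v w; rewrite /s linearPl /= scalerDr addrACA; congr (_ + _).
  by rewrite scalerA -scalerDl mulrDl mulrA.
pose sL := GRing.isLinear.Build F V V *:%R s s_lin.
pose s' : {linear V -> V} := HB.pack s sL.
exists (linfun s'); split=> [v w||v Qvxy]; rewrite !lfunE /= /s.
- rewrite linearDl !linearDr /= !symmetric_formZl !symmetric_formZr.
  rewrite Qaa (symmetric_formC a w); field.
  exact: Qxy.
- by rewrite Qa Qxx sub0r mulNr divff // scaleN1r.
- by rewrite Qa Qvxy subrr mul0r scale0r addr0.
Qed.

Hypothesis two_neq0 : (2 : F) != 0.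

(** No vector space is the union of two proper subspaces, so some u0 orthogonal
    to W is orthogonal neither to x nor to y.  Adding to it a multiple c *: x
    changes Q u0 u0 by 2 * c * Q u0 x, which can be made to cancel it when 2 is
    invertible, and keeps the products with x and y since Q x x = Q x y = 0. *)
Lemma isotropic_intermediate (W : {vspace V}) x y :
    x \notin W -> y \notin W -> x \in orthov Q W ->
    Q x x = 0 -> Q x y = 0 ->
  exists u, [/\ u \in orthov Q W, Q u u = 0, Q u x != 0 & Q u y != 0].
Proof.
move=> xW yW xoW Qxx Qxy.
have [u0 [u0W Qu0x Qu0y]] :
    exists u, [/\ u \in orthov Q W, Q u x != 0 & Q u y != 0].
  have [u uW Qux] := orthov_separation xW.
  have [w wW Qwy] := orthov_separation yW.
  have [Quy|] := eqVneq (Q u y) 0; last by exists u.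
  have [Qwx|] := eqVneq (Q w x) 0; last by exists w.
  exists (u + w); split; first exact: memvD.
    by rewrite linearDl /= Qwx addr0.
  by rewrite linearDl /= Quy add0r.
exists (u0 - (Q u0 u0 / (2 * Q u0 x)) *: x); split.
- by rewrite memvB // memvZ.
- rewrite linearBl !linearBr /= !symmetric_formZl !symmetric_formZr.
  rewrite Qxx (symmetric_formC x u0); field.
  by rewrite two_neq0 Qu0x.
- by rewrite linearBl /= symmetric_formZl Qxx mulr0 subr0.
- by rewrite linearBl /= symmetric_formZl Qxy mulr0 subr0.
Qed.

Lemma isometry_fixing (W : {vspace V}) x y :
    x \notin W -> y \notin W -> x \in orthov Q W -> y \in orthov Q W ->
    Q x x = 0 -> Q y y = 0 ->
  exists A : 'End(V), [/\ isometry Q Q A, A x = y & {in W, A =1 id}].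
Proof.
move=> xW yW xoW yoW Qxx Qyy.
have orthW v w : v \in W -> w \in orthov Q W -> Q v w = 0.
  by move=> vW /mem_orthovP wW; rewrite symmetric_formC wW.
have [Qxy|Qxy] := eqVneq (Q x y) 0; last first.
  have [A [isoA Axy fixA]] := isometry_of_isotropic_pair Qxx Qyy Qxy.
  by exists A; split=> // v vW; rewrite fixA // !orthW.
have [u [uoW Quu Qux Quy]] := isotropic_intermediate xW yW xoW Qxx Qxy.
rewrite symmetric_formC in Qux.
have [A [isoA Axu fixA]] := isometry_of_isotropic_pair Qxx Quu Qux.
have [B [isoB Buy fixB]] := isometry_of_isotropic_pair Quu Qyy Quy.
exists (B \o A)%VF; split; first exact: isometry_comp.
  by rewrite lfunE /= Axu.
by move=> v vW; rewrite lfunE /= fixA ?fixB // !orthW.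
Qed.

Lemma isometry_of_isotropic_free (X Y : seq V) :
    size X = size Y -> free X -> free Y ->
    {in X &, forall v w, Q v w = 0} -> {in Y &, forall v w, Q v w = 0} ->
  exists2 A : 'End(V), isometry Q Q A & map A X = Y.
Proof.
elim: X Y => [|x X IH] [|y Y] //=.
  by move=> _ _ _ _ _; exists \1%VF => // v w; rewrite !lfunE.
move=> [eq_size] freeX freeY isoX isoY.
have [xX frX] : x \notin <<X>>%VS /\ free X.
  by move: freeX; rewrite free_cons => /andP[].
have [yY frY] : y \notin <<Y>>%VS /\ free Y.
  by move: freeY; rewrite free_cons => /andP[].
have [||A isoA AXY] := IH Y eq_size frX frY.
- by move=> v w vX wX; rewrite isoX // inE ?vX ?wX orbT.
- by move=> v w vY wY; rewrite isoY // inE ?vY ?wY orbT.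
have AxY : A x \notin <<Y>>%VS.
  rewrite -AXY -limg_span; apply: contra xX => /memv_imgP[z zX].
  by move=> /(bij_inj (isometry_bijective isoA)) ->.
have orthY v : {in Y, forall w, Q v w = 0} -> v \in orthov Q <<Y>>.
  move=> QvY; rewrite mem_orthov_sym; apply/span_subvP => w wY.
  by rewrite mem_orthov1 symmetric_formC QvY.
have [||||B [isoB BAxy fixB]] := isometry_fixing AxY yY.
- apply: orthY => w; rewrite -AXY => /mapP[z zX ->].
  by rewrite isoA isoX // inE ?eqxx ?zX ?orbT.
- by apply: orthY => w wY; rewrite isoY // inE ?eqxx ?wY ?orbT.
- by rewrite isoA isoX // mem_head.
- by rewrite isoY // mem_head.
exists (B \o A)%VF; first exact: isometry_comp.
rewrite lfunE /= BAxy; congr (_ :: _); rewrite -AXY.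
apply/eq_in_map => z zX; rewrite lfunE /= fixB // memv_span // -AXY.
exact: map_f.
Qed.

End Witt.

Theorem proposition2 (R : realType) (V : vectType R[i]) (m : nat)
    (dimV : \dim {:V} = m) (Q : {symmetric V}) (ndQ : nondegenerate Q)
    (k : nat) (L L' : {vspace V}) :
  isotropic_planes Q k L -> isotropic_planes Q k L' ->
  exists A : 'End(V), orthogonal_group Q A /\ (A @: L)%VS = L'.
Proof.
move=> [dimL isoL] [dimL' isoL'].
have two_neq0 : (2 : R[i]) != 0 by rewrite pnatr_eq0.
have [|||||A isoA AL] :=
  isometry_of_isotropic_free ndQ two_neq0 (X := vbasis L) (Y := vbasis L').
- by rewrite !size_tuple dimL dimL'.
- exact: basis_free (vbasisP L).
- exact: basis_free (vbasisP L').
- by move=> v w /vbasis_mem vL /vbasis_mem wL; apply: isoL.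
- by move=> v w /vbasis_mem vL /vbasis_mem wL; apply: isoL'.
exists A; split; first by split=> //; apply: isometry_bijective isoA.
by rewrite -(span_basis (vbasisP L)) limg_span AL (span_basis (vbasisP L')).
Qed.
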